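(* There exists a unique bilinear form $(\cdot,\cdot):F\times F\to\mathbb{Q}(q)$ such that $(1,1)=1$ and the following properties hold for all homogeneous elements: (a) $(a_{il},a_{jk})=\delta_{ij}\delta_{lk}\bigl(1-(-1)^{p(li)}q_i^{2l}\bigr)^{-1}$ for all $(i,l),(j,k)\in I^\infty$; (b) $(x,yy')=(\varrho(x),y\otimes y')$ for all $x,y,y'\in F$; (c) $(xx',y)=(x\otimes x',\varrho(y))$ for all $x,x',y\in F$. Here $(\cdot,\cdot)$ also denotes the induced bilinear form on $F\otimes F$ given by $(x_1\otimes x_2,x_3\otimes x_4)=(x_1,x_3)(x_2,x_4)$. Moreover, the bilinear form on $F$ is symmetric.
   Context: Let $I$ be a finite or countably infinite index set and $A=(a_{ij})_{i,j\in I}$ a symmetrizable Borcherds–Cartan matrix: integer entries, $a_{ii}\in\{2,0,-2,-4,\dots\}$, $a_{ij}\le 0$ for $i\ne j$, and positive integers $d_i$ with $d_ia_{ij}=d_ja_{ji}$ are fixed. Let $I=I_{\bar0}\sqcup I_{\bar1}$ with $a_{ij}\in2\mathbb{Z}$ for all $i\in I_{\bar1}$, $j\in I$; set $p(i)=0$ for $i\in I_{\bar0}$, $p(i)=1$ for $i\in I_{\bar1}$. Put $I^{\mathrm{re}}=\{i:a_{ii}=2\}$, $I^{\mathrm{im}}=\{i:a_{ii}\le0\}$, $I^\infty=(I^{\mathrm{re}}\times\{1\})\sqcup(I^{\mathrm{im}}\times\mathbb{Z}_{>0})$, and $p(li)\in\{0,1\}$ with $p(li)\equiv l\,p(i)\pmod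 2$. The root lattice is $Q=\bigoplus_{i\in I}\mathbb{Z}\alpha_i$ with symmetric form $(\alpha_i,\alpha_j)=d_ia_{ij}$. Set $q_i=q^{d_i}$. $F$ is the free associative unital $\mathbb{Q}(q)$-algebra on generators $a_{il}$, $(i,l)\in I^\infty$, with parity $p(a_{il})=p(li)$ and weight $|a_{il}|=l\alpha_i$, extended multiplicatively. $F\otimes F$ is an algebra with product $(x_1\otimes x_2)(x_3\otimes x_4)=(-1)^{p(x_2)p(x_3)}q^{(|x_2|,|x_3|)}x_1x_3\otimes x_2x_4$ on homogeneous elements (homogeneous with respect to weight and parity). $\varrho:F\to F\otimes F$ is the algebra homomorphism with $\varrho(a_{il})=a_{il}\otimes1+1\otimes a_{il}$. *)

(* Defs.v *)
From HB Require Import structures.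
From mathcomp Require Import all_boot all_order all_algebra finmap monalg.

Set Implicit Arguments.
Unset Strict Implicit.
Unset Printing Implicit Defensive.

Import Order.TTheory GRing.Theory Num.Theory.
Local Open Scope ring_scope.

Section LinearExtension.
Variables (R : comNzRingType) (K : choiceType).
Implicit Types x y : {malg R[K]}.

(* The linear map out of the free module {malg R[K]} with values h on the
   basis. *)
Definition linext (V : lmodType R) (h : K -> V) x : V :=
  \sum_(k <- msupp x) x@_k *: h k.

Lemma linextEw (V : lmodType R) (d : {fset K}) (h : K -> V) x :
  (msupp x `<=` d)%fset -> linext h x = \sum_(k <- d) x@_k *: h k.
Proof.
move=> le; rewrite /linext (big_fset_incl _ le) //= => k _ /mcoeff_outdom ->.
by rewrite scale0r.
Qed.

Lemma linext_is_linear (V : lmodType R) (h : K -> V) : linear (linext h).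
Proof.
move=> a x y; pose d := (msupp x `|` msupp y)%fset.
have le1 : (msupp x `<=` d)%fset by apply: fsubsetUl.
have le2 : (msupp y `<=` d)%fset by apply: fsubsetUr.
have le3 : (msupp (a *: x + y) `<=` d)%fset.
  by apply: fsubset_trans (msuppD_le _ _) (fsetSU _ (msuppZ_le _ _)).
rewrite (linextEw h le1) (linextEw h le2) (linextEw h le3).
rewrite scaler_sumr -big_split /=; apply: eq_bigr => k _.
by rewrite mcoeffD mcoeffZ scalerDl scalerA.
Qed.

HB.instance Definition _ (V : lmodType R) (h : K -> V) :=
  GRing.isLinear.Build R {malg R[K]} V *:%R (linext h) (linext_is_linear h).

Lemma linextU (V : lmodType R) (h : K -> V) k : linext h << k >> = h k.
Proof. by rewrite (linextEw h msuppU_le) big_seq_fset1 mcoeffUU scale1r. Qed.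

Lemma eq_linext_in (V : lmodType R) (h h' : K -> V) x :
  {in msupp x, h =1 h'} -> linext h x = linext h' x.
Proof.
by move=> eqh; apply: eq_big_seq => k kx; rewrite eqh.
Qed.

Lemma eq_linext (V : lmodType R) (h h' : K -> V) x :
  h =1 h' -> linext h x = linext h' x.
Proof. by move=> eqh; apply: eq_linext_in. Qed.

Lemma linextDZ (V : lmodType R) a (h h' : K -> V) x :
  linext (fun k => a *: h k + h' k) x = a *: linext h x + linext h' x.
Proof.
rewrite /linext scaler_sumr -big_split /=; apply: eq_bigr => k _.
by rewrite scalerDr !scalerA mulrC.
Qed.

Lemma malg_ind (P : {malg R[K]} -> Prop) :
  P 0 -> (forall k, P << k >>) ->
  (forall a x y, P x -> P y -> P (a *: x + y)) -> forall x, P x.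
Proof.
move=> P0 PU PD x; rewrite [x]monalgE.
elim: {1}(enum_fset (msupp x)) => [|k s IHs]; first by rewrite big_nil.
rewrite big_cons (_ : << _ *g k >> = x@_k *: << k >>); first exact: PD.
by apply/malgP => l; rewrite mcoeffZ !mcoeffU mulr_natr.
Qed.

Lemma malg_linear_eq (V : lmodType R) (f g : {malg R[K]} -> V) x :
    linear f -> linear g -> {in msupp x, forall k, f << k >> = g << k >>} ->
  f x = g x.
Proof.
suff E (h : {malg R[K]} -> V) : linear h -> h x = linext (fun k => h << k >>) x.
  by move=> lf lg efg; rewrite (E f) // (E g) //; apply: eq_linext_in.
move=> lh; elim/malg_ind: x => [|k|a x x' IHx IHx'].
- by have := lh (-1) 0 0; rewrite scaler0 addr0 scaleN1r addNr linear0.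
- by rewrite linextU.
- by rewrite lh IHx IHx' linearP.
Qed.

End LinearExtension.

Lemma malgZU (R : nzRingType) (K : choiceType) (a : R) (k : K) :
  a *: << k >> = << a *g k >>.
Proof. by apply/malgP => l; rewrite mcoeffZ !mcoeffU mulr_natr. Qed.

Lemma malgMUU (R : nzRingType) (M : monomType) (k l : M) :
  << k >> * << l >> = << mmul k l >> :> {malg R[M]}.
Proof. by rewrite malgM_def fgmulUU mulr1. Qed.

Lemma malgZAr (R : comNzRingType) (M : monomType) a (x y : {malg R[M]}) :
  a *: (x * y) = x * (a *: y).
Proof.
apply/malgP => k; rewrite mcoeffZ mcoeffMl.
rewrite (mcoeffMlw _ (fsubset_refl _) (msuppZ_le a y)) mulr_sumr.
apply: eq_bigr => l _; rewrite mulr_sumr; apply: eq_bigr => m _.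
by rewrite mcoeffZ mulrnAr mulrCA.
Qed.

Section BilinearExtension.
Variables (R : comNzRingType) (K L : choiceType) (V : lmodType R).
Variable h : K -> L -> V.
Implicit Types (x : {malg R[K]}) (y : {malg R[L]}).

Definition bilext x y : V := linext (fun k => linext (h k) y) x.

Lemma bilextUU k l : bilext << k >> << l >> = h k l.
Proof. by rewrite /bilext !linextU. Qed.

Lemma bilextPl y a : {morph bilext^~ y : x x' / a *: x + x'}.
Proof. by move=> x x'; rewrite /bilext linearP. Qed.

Lemma bilextPr x a : {morph bilext x : y y' / a *: y + y'}.
Proof.
move=> y y'; rewrite /bilext -linextDZ; apply: eq_linext => k.
by rewrite linearP.
Qed.

HB.instance Definition _ := bilinear_isBilinear.Build R
  {malg R[K]} {malg R[L]} V *:%R *:%R bilext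
  ((fun y a => bilextPl y a), (fun x a => bilextPr x a)).

Lemma bilextDl y : {morph bilext^~ y : x x' / x + x'}.
Proof. by move=> x x'; rewrite /bilext linearD. Qed.

Lemma bilextDr x : {morph bilext x : y y' / y + y'}.
Proof. exact: linearDr. Qed.

Lemma bilextZl y a : {morph bilext^~ y : x / a *: x}.
Proof. by move=> x; rewrite /bilext linearZ. Qed.

Lemma bilextZr x a : {morph bilext x : y / a *: y}.
Proof. exact: linearZr_LR. Qed.

Lemma bilext0l y : bilext 0 y = 0.
Proof. by rewrite /bilext linear0. Qed.

Lemma bilext0r x : bilext x 0 = 0.
Proof. exact: linear0r. Qed.
End BilinearExtension.

(* The free R-module on a monoid (K, op, e), with the product
   k * l = c k l *: op k l on the basis; it is associative and unital when c is
   a normalized 2-cocycle. *)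
Section TwistedProduct.
Variables (R : comNzRingType) (K : choiceType) (op : K -> K -> K) (e : K).
Variable c : K -> K -> R.
Implicit Types x y z : {malg R[K]}.

Definition twmul : {malg R[K]} -> {malg R[K]} -> {malg R[K]} :=
  bilext (fun k l => c k l *: << op k l >>).

Hypotheses (opA : associative op) (op1k : left_id e op) (opk1 : right_id e op).
Hypothesis cA : forall k l m, c k l * c (op k l) m = c l m * c k (op l m).
Hypotheses (c1k : forall k, c e k = 1) (ck1 : forall k, c k e = 1).

Lemma twmulUU k l : twmul << k >> << l >> = c k l *: << op k l >>.
Proof. exact: bilextUU. Qed.

Lemma twmulA : associative twmul.
Proof.
move=> x y z; elim/malg_ind: x => [|k|a x x' IHx IHx'].
- by rewrite /twmul !bilext0l.
- elim/malg_ind: y => [|l|a y y' IHy IHy'].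
  + by rewrite /twmul !(bilext0l, bilext0r).
  + elim/malg_ind: z => [|m|a z z' IHz IHz'].
    * by rewrite /twmul !bilext0r.
    * rewrite !twmulUU /twmul bilextZl bilextZr !bilextUU !scalerA.
      by rewrite -opA cA.
    * by rewrite /twmul !bilextPr -!/(twmul _ _) IHz IHz'.
  + by rewrite /twmul bilextPr !bilextPl bilextPr -!/(twmul _ _) IHy IHy'.
- by rewrite /twmul !bilextPl -!/(twmul _ _) IHx IHx'.
Qed.

Lemma twmul1x : left_id << e >> twmul.
Proof.
elim/malg_ind => [|k|a x x' IHx IHx'].
- by rewrite /twmul bilext0r.
- by rewrite twmulUU c1k scale1r op1k.
- by rewrite /twmul bilextPr -!/(twmul _ _) IHx IHx'.
Qed.

Lemma twmulx1 : right_id << e >> twmul.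
Proof.
elim/malg_ind => [|k|a x x' IHx IHx'].
- by rewrite /twmul bilext0l.
- by rewrite twmulUU ck1 scale1r opk1.
- by rewrite /twmul bilextPl -!/(twmul _ _) IHx IHx'.
Qed.

Lemma twmulDl : left_distributive twmul +%R.
Proof. by move=> x x' y; apply: bilextDl. Qed.

Lemma twmulDr : right_distributive twmul +%R.
Proof. by move=> x y y'; apply: bilextDr. Qed.

Lemma twmulZl a x y : a *: twmul x y = twmul (a *: x) y.
Proof. by rewrite /twmul bilextZl. Qed.

Lemma twmulZr a x y : a *: twmul x y = twmul x (a *: y).
Proof. by rewrite /twmul bilextZr. Qed.
End TwistedProduct.

(* Q(q) and q *)
Notation Qq := {fraction {poly rat}}.
Notation qq := (FracField.tofrac ('X : {poly rat})).

(* A symmetrizable Borcherds-Cartan matrix with a fixed symmetrization d and a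
   fixed set bc_odd of odd indices; countType covers both the finite and the
   countably infinite index sets. *)
Record bcDatum (I : countType) := BCDatum {
  bc_a : I -> I -> int;
  bc_d : I -> nat;
  bc_odd : pred I;
  bc_a_diag : forall i, (bc_a i i <= 2) && (2 %| bc_a i i)%Z;
  bc_a_offdiag : forall i j, i != j -> bc_a i j <= 0;
  bc_d_gt0 : forall i, (0 < bc_d i)%N;
  bc_sym : forall i j, (bc_d i)%:Z * bc_a i j = (bc_d j)%:Z * bc_a j i;
  bc_odd_even : forall i j, bc_odd i -> (2 %| bc_a i j)%Z
}.

Section Datum.
Variables (I : countType) (D : bcDatum I).

Definition I_re : pred I := fun i => bc_a D i i == 2.
Definition I_im : pred I := fun i => bc_a D i i <= 0.

Definition in_Iinf : pred (I * nat) :=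
  fun x => (I_re x.1 && (x.2 == 1%N)) || (I_im x.1 && (0 < x.2)%N).
Definition Iinf : Type := {x : I * nat | in_Iinf x}.

Definition idx (a : Iinf) : I := (val a).1.
Definition lev (a : Iinf) : nat := (val a).2.

Definition rootLattice := {malg int[I]}.
Definition alpha (i : I) : rootLattice := << i >>.
Definition root_form : rootLattice -> rootLattice -> int :=
  bilext (fun i j => (bc_d D i)%:Z * bc_a D i j : int^o).

Definition qi (i : I) : Qq := qq ^+ bc_d D i.

Definition word := {fmonom Iinf}.
Definition wt (w : word) : rootLattice := \sum_(a <- w) alpha (idx a) *+ lev a.
Definition par_gen (a : Iinf) : bool := odd (lev a * bc_odd D (idx a)).
Definition par (w : word) : bool := \big[addb/false]_(a <- w) par_gen a.

Lemma wtM (u v : word) : wt (mmul u v) = wt u + wt v.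
Proof. by rewrite /wt fmM big_cat. Qed.

Lemma wt1 : wt mone = 0.
Proof. by rewrite /wt fm1 big_nil. Qed.

Lemma parM (u v : word) : par (mmul u v) = par u (+) par v.
Proof. by rewrite /par fmM big_cat. Qed.

Lemma par1 : par mone = false.
Proof. by rewrite /par fm1 big_nil. Qed.

Local Notation F := {malg Qq[word]}.

Definition gen (a : Iinf) : F := << fmu a >>.

(* Homogeneous of weight mu and parity e; words are the homogeneous basis of the
   weight and parity gradings of F. *)
Definition homogeneous (x : F) (mu : rootLattice) (e : bool) : Prop :=
  forall w, w \in msupp x -> wt w = mu /\ par w = e.

Definition twist (mu nu : rootLattice) (e f : bool) : Qq :=
  (-1) ^+ (e && f) * qq ^ root_form mu nu.

(* F (x) F, on the basis of pairs of words; (u, v) stands for u (x) v. *)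
Definition FF : Type := {malg Qq[(word * word)%type]}.
HB.instance Definition _ := GRing.Lmodule.copy FF {malg Qq[(word * word)%type]}.

Definition tens : F -> F -> FF := bilext (fun u v => << (u, v) >> : FF).

Lemma qq_neq0 : qq != 0 :> Qq.
Proof. by rewrite tofrac_eq0 polyX_eq0. Qed.

Lemma root_formDl mu mu' nu :
  root_form (mu + mu') nu = root_form mu nu + root_form mu' nu.
Proof. exact: (bilextDl (fun i j => (bc_d D i)%:Z * bc_a D i j : int^o) nu mu mu'). Qed.

Lemma root_formDr mu nu nu' :
  root_form mu (nu + nu') = root_form mu nu + root_form mu nu'.
Proof. exact: (bilextDr (fun i j => (bc_d D i)%:Z * bc_a D i j : int^o) mu nu nu'). Qed.

Lemma twistDl mu mu' nu e e' f :
  twist (mu + mu') nu (e (+) e') f = twist mu nu e f * twist mu' nu e' f.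
Proof.
rewrite /twist root_formDl expfzDr ?qq_neq0 // mulrACA; congr (_ * _).
by case: e e' f => [] [] []; rewrite /= ?(expr0, expr1, mulrNN, mulr1, mul1r).
Qed.

Lemma twistDr mu nu nu' e f f' :
  twist mu (nu + nu') e (f (+) f') = twist mu nu e f * twist mu nu' e f'.
Proof.
rewrite /twist root_formDr expfzDr ?qq_neq0 // mulrACA; congr (_ * _).
by case: e f f' => [] [] []; rewrite /= ?(expr0, expr1, mulrNN, mulr1, mul1r).
Qed.

Lemma twist0l nu f : twist 0 nu false f = 1.
Proof. by rewrite /twist [root_form _ _]bilext0l expr0z mulr1. Qed.

Lemma twist0r mu e : twist mu 0 e false = 1.
Proof. by rewrite /twist [root_form _ _]bilext0r expr0z andbF mulr1. Qed.

Definition opW (k l : word * word) := (mmul k.1 l.1, mmul k.2 l.2).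
Definition oneW : word * word := (mone, mone).
Definition cW (k l : word * word) : Qq := twist (wt k.2) (wt l.1) (par k.2) (par l.1).

Lemma opWA : associative opW.
Proof. by move=> k l m; rewrite /opW /= !mulmA. Qed.

Lemma opW1k : left_id oneW opW.
Proof. by case=> u v; rewrite /opW /= !mul1m. Qed.

Lemma opWk1 : right_id oneW opW.
Proof. by case=> u v; rewrite /opW /= !mulm1. Qed.

Lemma cWA k l m : cW k l * cW (opW k l) m = cW l m * cW k (opW l m).
Proof.
rewrite /cW /opW /= !wtM !parM twistDl twistDr.
by rewrite mulrA mulrC.
Qed.

Lemma cW1k k : cW oneW k = 1.
Proof. by rewrite /cW wt1 par1 twist0l. Qed.

Lemma cWk1 k : cW k oneW = 1.
Proof. by rewrite /cW wt1 par1 twist0r. Qed.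

Lemma oneW_neq0 : << oneW >> != 0 :> {malg Qq[(word * word)%type]}.
Proof. by rewrite monalgU_eq0 oner_neq0. Qed.

(* The product of F (x) F is given on words; tensM below is the defining formula
   for homogeneous elements. *)
HB.instance Definition _ := GRing.Zmodule_isNzRing.Build FF
  (twmulA opWA cWA) (twmul1x opW1k cW1k) (twmulx1 opWk1 cWk1)
  (twmulDl opW cW) (twmulDr opW cW) oneW_neq0.
HB.instance Definition _ := GRing.Lmodule_isLalgebra.Build Qq FF
  (twmulZl opW cW).
HB.instance Definition _ := GRing.Lalgebra_isAlgebra.Build Qq FF
  (twmulZr opW cW).

Lemma FF_mulUU (k l : word * word) : (<< k >> : FF) * (<< l >> : FF) =
  twist (wt k.2) (wt l.1) (par k.2) (par l.1) *:
    (<< (mmul k.1 l.1, mmul k.2 l.2) >> : FF).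
Proof. exact: twmulUU. Qed.

Lemma tensUU (u v : word) : tens << u >> << v >> = << (u, v) >>.
Proof. exact: bilextUU. Qed.

Lemma tensPl y a : {morph tens^~ y : x x' / a *: x + x'}.
Proof. exact: bilextPl. Qed.

Lemma tensPr x a : {morph tens x : y y' / a *: y + y'}.
Proof. exact: bilextPr. Qed.

Lemma tens0l y : tens 0 y = 0. Proof. exact: bilext0l. Qed.
Lemma tens0r x : tens x 0 = 0. Proof. exact: bilext0r. Qed.

Lemma tensM x1 x2 x3 x4 mu nu e f :
    homogeneous x2 mu e -> homogeneous x3 nu f ->
  tens x1 x2 * tens x3 x4 = twist mu nu e f *: tens (x1 * x3) (x2 * x4).
Proof.
move=> hx2 hx3.
apply: (malg_linear_eq (f := fun y => tens x1 y * tens x3 x4)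
  (g := fun y => twist mu nu e f *: tens (x1 * x3) (y * x4))).
- by move=> a y y'; rewrite tensPr mulrDl -scalerAl.
- move=> a y y'; rewrite mulrDl -scalerAl tensPr scalerDr !scalerA.
  by rewrite [a * _]mulrC.
move=> v /hx2[<- <-].
apply: (malg_linear_eq (f := fun z => tens x1 << v >> * tens z x4)
  (g := fun z => twist (wt v) nu (par v) f *: tens (x1 * z) (<< v >> * x4))).
- by move=> a z z'; rewrite tensPl mulrDr -scalerAr.
- move=> a z z'; rewrite mulrDr -malgZAr tensPl scalerDr !scalerA.
  by rewrite [a * _]mulrC.
move=> w /hx3[<- <-]; set t := twist _ _ _ _.
apply: (malg_linear_eq (f := fun z => tens z << v >> * tens << w >> x4)
  (g := fun z => t *: tens (z * << w >>) (<< v >> * x4))).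
- by move=> a z z'; rewrite tensPl mulrDl -scalerAl.
- move=> a z z'; rewrite mulrDl -scalerAl tensPl scalerDr !scalerA.
  by rewrite [a * _]mulrC.
move=> u _.
apply: (malg_linear_eq (f := fun z => tens << u >> << v >> * tens << w >> z)
  (g := fun z => t *: tens (<< u >> * << w >>) (<< v >> * z))).
- by move=> a z z'; rewrite tensPr mulrDr -scalerAr.
- move=> a z z'; rewrite mulrDr -malgZAr tensPr scalerDr !scalerA.
  by rewrite [a * _]mulrC.
by move=> u' _; rewrite !malgMUU !tensUU FF_mulUU.
Qed.

(* rho extends a |-> a (x) 1 + 1 (x) a to words by products taken in F (x) F;
   the instances below make it the algebra morphism F -> F (x) F. *)
Definition rho (x : F) : FF :=
  linext (fun w : word => \prod_(a <- w) (tens (gen a) 1 + tens 1 (gen a)) : FF) x.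

Lemma rho_is_linear : linear rho.
Proof. exact: linext_is_linear. Qed.

Lemma rhoU (w : word) :
  rho << w >> = \prod_(a <- w) (tens (gen a) 1 + tens 1 (gen a)).
Proof. exact: linextU. Qed.

Lemma rho_gen a : rho (gen a) = tens (gen a) 1 + tens 1 (gen a).
Proof. by rewrite rhoU fmU big_seq1. Qed.

Lemma rho_is_monoid_morphism : monoid_morphism rho.
Proof.
split=> [|x y]; first by rewrite rhoU fm1 big_nil.
apply: (malg_linear_eq (f := fun x => rho (x * y)) (g := fun x => rho x * rho y)).
- by move=> a z z'; rewrite mulrDl -scalerAl rho_is_linear.
- by move=> a z z'; rewrite rho_is_linear mulrDl -scalerAl.
move=> u _.
apply: (malg_linear_eq (f := fun y => rho (<< u >> * y))
  (g := fun y => rho << u >> * rho y)).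
- by move=> a z z'; rewrite mulrDr -malgZAr rho_is_linear.
- by move=> a z z'; rewrite rho_is_linear mulrDr -scalerAr.
by move=> v _; rewrite malgMUU !rhoU fmM big_cat.
Qed.

HB.instance Definition _ :=
  GRing.isLinear.Build Qq F FF *:%R rho rho_is_linear.
HB.instance Definition _ :=
  GRing.isMonoidMorphism.Build F FF rho rho_is_monoid_morphism.

(* The form induced by B on F (x) F; see tform_tens. *)
Definition tform (B : F -> F -> Qq) : FF -> FF -> Qq :=
  bilext (fun k l => B << k.1 >> << l.1 >> * B << k.2 >> << l.2 >> : Qq^o).

Lemma tformPl B v a u u' :
  tform B (a *: u + u') v = a * tform B u v + tform B u' v.
Proof. by rewrite /tform bilextPl. Qed.

Lemma tformPr B u a v v' :
  tform B u (a *: v + v') = a * tform B u v + tform B u v'.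
Proof. by rewrite /tform bilextPr. Qed.

Lemma tform_tens (B : {bilinear F -> F -> Qq | *%R & *%R}) x1 x2 x3 x4 :
  tform B (tens x1 x2) (tens x3 x4) = B x1 x3 * B x2 x4.
Proof.
apply: (malg_linear_eq (V := Qq^o)
  (f := fun z => tform B (tens z x2) (tens x3 x4))
  (g := fun z => B z x3 * B x2 x4)).
- by move=> a z z'; rewrite tensPl tformPl.
- by move=> a z z'; rewrite linearPl mulrDl -mulrA.
move=> u1 _.
apply: (malg_linear_eq (V := Qq^o)
  (f := fun z => tform B (tens << u1 >> z) (tens x3 x4))
  (g := fun z => B << u1 >> x3 * B z x4)).
- by move=> a z z'; rewrite tensPr tformPl.
- by move=> a z z'; rewrite linearPl mulrDr mulrCA.
move=> u2 _.
apply: (malg_linear_eq (V := Qq^o)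
  (f := fun z => tform B (tens << u1 >> << u2 >>) (tens z x4))
  (g := fun z => B << u1 >> z * B << u2 >> x4)).
- by move=> a z z'; rewrite tensPl tformPr.
- by move=> a z z'; rewrite linearPr mulrDl -mulrA.
move=> u3 _.
apply: (malg_linear_eq (V := Qq^o)
  (f := fun z => tform B (tens << u1 >> << u2 >>) (tens << u3 >> z))
  (g := fun z => B << u1 >> << u3 >> * B << u2 >> z)).
- by move=> a z z'; rewrite tensPr tformPr.
- by move=> a z z'; rewrite linearPr mulrDr mulrCA.
by move=> u4 _; rewrite !tensUU /tform bilextUU.
Qed.

(* The conditions are imposed on all elements; by bilinearity this amounts to
   imposing them on homogeneous ones. *)
Definition is_lusztig_form (B : F -> F -> Qq) : Prop :=
  [/\ B 1 1 = 1,
      forall a b : Iinf, B (gen a) (gen b) =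
        (idx a == idx b)%:R * (lev a == lev b)%:R *
          (1 - (-1) ^+ par_gen a * qi (idx a) ^+ (2 * lev a))^-1,
      forall x y y' : F, B x (y * y') = tform B (rho x) (tens y y') &
      forall x x' y : F, B (x * x') y = tform B (tens x x') (rho y)].

End Datum.

Notation freeF D := {malg Qq[word D]}.

(* Main.v *)
Require Import Defs.
From HB Require Import structures.
From mathcomp Require Import all_boot all_order all_algebra finmap monalg.

Set Implicit Arguments.
Unset Strict Implicit.
Unset Printing Implicit Defensive.

Import Order.TTheory GRing.Theory Num.Theory.
Local Open Scope ring_scope.

(** Write e_a for the prescribed norm of the generator a. If the form exists,
    (c) gives (a x, y) = (a (x) x, rho y). Since a pairs to zero with every word
    other than the one-letter word a, only the part a (x) F of rho y matters, so
      (a x, y) = (x, d_a y),   where d_a = ((a, -) (x) id) o rho.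
    The map d_a is a skew derivation:
      d_a (b y) = [a = b] e_a y + t(b, a) b d_a y,
    where t(b, a) is the sign times the power of q by which b and a are
    interchanged in F (x) F.

    Existence: [skewder] is d_a, defined by this recursion on words, and
    [lusztig_form] is defined by (1, y) = constant coefficient of y and
    (a x, y) = (x, d_a y).
    - (c) follows by induction on x from rho o d_a = (d_a (x) id) o rho
      ([rho_skewder]), an instance of coassociativity; the base case is the
      counit property of rho ([counitl_rho]).
    - (b) follows by induction on x from the twisted Leibniz rule for d_a
      ([skewder_mulU]). On one side a is carried across the left factor of a
      term of rho x, on the other across the left factor of y y'. The two
      twists agree because t is symmetric and words of different weight or
      parity are orthogonal ([lusztig_form_wt]).

    Uniqueness: (b) and (c) force 1 to be orthogonal to every generator, so the
    pairings of 1 and of the generators with all words are determined by (a) and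
    (b); then (c) determines the form by induction on the first argument.

    Symmetry: (b) and (c) are exchanged by transposing the form and (a) is
    symmetric, so the transposed form has the same properties and uniqueness
    applies. *)

(** * Linear maps *)

Lemma linextE (R : comNzRingType) (K : choiceType) (V : lmodType R)
    (f : {malg R[K]} -> V) x :
  linear f -> f x = linext (fun k => f << k >>) x.
Proof.
move=> lf; apply: malg_linear_eq => //; first exact: linext_is_linear.
by move=> k _; rewrite linextU.
Qed.

Section Linearity.
Variables (R : comNzRingType) (U V W : lmodType R).

Lemma linear_addZ (f : U -> V) :
  linear f -> forall t x y, f (x + t *: y) = f x + t *: f y.
Proof. by move=> lf t x y; rewrite addrC lf addrC. Qed.

Lemma linear_0 (f : U -> V) : linear f -> f 0 = 0.
Proof.
by move=> lf; have := lf (-1) 0 0; rewrite scaler0 addr0 scaleN1r addNr.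
Qed.

Lemma linear_Z (f : U -> V) : linear f -> forall t x, f (t *: x) = t *: f x.
Proof.
by move=> lf t x; have := lf t x 0; rewrite !addr0 (linear_0 lf) addr0.
Qed.

Lemma linear_comp (f : V -> W) (g : U -> V) :
  linear f -> linear g -> linear (f \o g).
Proof. by move=> lf lg c x y /=; rewrite lg lf. Qed.

Lemma linear_comb (s t : R) (f g : U -> V) :
  linear f -> linear g -> linear (fun x => s *: f x + t *: g x).
Proof.
move=> lf lg c x y; rewrite lf lg !scalerDr !scalerA addrACA.
by rewrite (mulrC c) (mulrC c t).
Qed.

Lemma linear_add (f g : U -> V) :
  linear f -> linear g -> linear (fun x => f x + g x).
Proof. by move=> lf lg c x y; rewrite lf lg scalerDr addrACA. Qed.

Lemma linear_scale (t : R) (f : U -> V) :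
  linear f -> linear (fun x => t *: f x).
Proof. by move=> lf c x y; rewrite lf scalerDr !scalerA mulrC. Qed.

(** The shape of one step of the commutation of d_a with left multiplication by
    rho b: m and m' are the products of rho b with u (x) v and with
    d_a u (x) v, each expanded into its two terms. *)
Lemma linear_twisted_sum (f : U -> V) (c t r s : R) (m p q : U)
    (z m' p' q' : V) :
    linear f -> m = p + s *: q -> f p = c *: z + t *: p' -> f q = q' ->
    m' = p' + r *: q' -> t * r = s ->
  f m = c *: z + t *: m'.
Proof.
move=> lf -> fp fq -> <-.
by rewrite (linear_addZ lf) fp fq scalerDr scalerA addrA.
Qed.

Lemma linear_id : linear (@id U).
Proof. by []. Qed.
End Linearity.

Lemma linear_mull (R : comNzRingType) (A : algType R) (x : A) :
  linear (fun y => x * y).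
Proof. by move=> c y z; rewrite mulrDr scalerAr. Qed.

Lemma linear_mulr (R : comNzRingType) (A : lalgType R) (x : A) :
  linear (fun y => y * x).
Proof. by move=> c y z; rewrite mulrDl scalerAl. Qed.

Lemma malg_linear_mull (R : comNzRingType) (M : monomType) (x : {malg R[M]}) :
  linear (fun y => x * y).
Proof. by move=> c y z; rewrite mulrDr malgZAr. Qed.

(** The induction step that carries the Leibniz rule from letters to words: the
    term c *: z is absorbed because d (g * u) contains c *: u. *)
Lemma skew_leibniz (R : comNzRingType) (A : lalgType R) (d : A -> A)
    (g u y : A) (c t s : R) :
    (forall (k : R) (x x' : A), k *: (x * x') = x * (k *: x')) ->
    (forall z, d (g * z) = c *: z + t *: (g * d z)) ->
    d (u * y) = d u * y + s *: (u * d y) ->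
  d (g * u * y) = d (g * u) * y + (t * s) *: (g * u * d y).
Proof.
move=> scAr dg du; rewrite -mulrA !dg du mulrDl mulrDr -!scalerAl -scAr.
by rewrite scalerDr scalerA addrA !mulrA.
Qed.

(** * Words, weights and the twist *)

Section Form.
Variables (I : countType) (D : bcDatum I).

Local Notation F := {malg Qq[word D]}.
Local Notation FF := (FF D).
Implicit Types (a b : Iinf D) (u v w : word D) (x y z : F).

Lemma word_ind (P : word D -> Prop) :
  P mone -> (forall a w, P w -> P (mmul (fmu a) w)) -> forall w, P w.
Proof.
move=> P1 PM [s]; elim: s => [|a s IHs].
  by rewrite (_ : FMonom _ = mone) //; apply: val_inj; rewrite /= fm1.
rewrite (_ : FMonom _ = mmul (fmu a) (FMonom s)); first exact: PM.
by apply: val_inj; rewrite /= fmM fmU.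
Qed.

Lemma homogeneousU w : homogeneous << w >> (wt w) (par w).
Proof. by move=> v; rewrite msuppU1 in_fset1 => /eqP->. Qed.

Lemma homogeneous_lin (f : F -> F) x mu e : linear f ->
  {in msupp x, forall w, homogeneous (f << w >>) mu e} ->
  homogeneous (f x) mu e.
Proof.
move=> lf hf; rewrite (linextE x lf) /linext big_seq.
elim/big_ind: _ => [w|y z hy hz w|w /hf hw v].
- by rewrite msupp0.
- by move/(fsubsetP (msuppD_le _ _)); rewrite in_fsetU => /orP[/hy|/hz].
- by move/(fsubsetP (msuppZ_le _ _))/hw.
Qed.

Lemma homogeneousD x y mu e :
  homogeneous x mu e -> homogeneous y mu e -> homogeneous (x + y) mu e.
Proof.
by move=> hx hy w /(fsubsetP (msuppD_le _ _)); rewrite in_fsetU => /orP[/hx|/hy].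
Qed.

Lemma homogeneous0 mu e : @homogeneous I D 0 mu e.
Proof. by move=> w; rewrite msupp0. Qed.

Lemma homogeneousZ c x mu e : homogeneous x mu e -> homogeneous (c *: x) mu e.
Proof. by move=> hx w /(fsubsetP (msuppZ_le _ _))/hx. Qed.

Lemma homogeneous_mulU u x mu e : homogeneous x mu e ->
  homogeneous (<< u >> * x) (wt u + mu) (par u (+) e).
Proof.
move=> hx; apply: (homogeneous_lin (f := fun x => << u >> * x)).
  exact: malg_linear_mull.
move=> w /hx[<- <-]; rewrite malgMUU -wtM -parM; exact: homogeneousU.
Qed.

Definition wtwist u v : Qq := twist D (wt u) (wt v) (par u) (par v).

Lemma root_formC mu nu : root_form D mu nu = root_form D nu mu.
Proof.
apply: (malg_linear_eq (V := int^o) (f := root_form D ^~ nu)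
  (g := root_form D nu)).
- by move=> c y y'; rewrite /root_form bilextPl.
- by move=> c y y'; rewrite /root_form bilextPr.
move=> i _; apply: (malg_linear_eq (V := int^o)
  (f := root_form D << i >>) (g := root_form D ^~ << i >>)).
- by move=> c y y'; rewrite /root_form bilextPr.
- by move=> c y y'; rewrite /root_form bilextPl.
by move=> j _; rewrite /root_form !bilextUU bc_sym.
Qed.

Lemma twistC mu nu e f : twist D mu nu e f = twist D nu mu f e.
Proof. by rewrite /twist root_formC andbC. Qed.

Lemma wtwistMl u u' v : wtwist (mmul u u') v = wtwist u v * wtwist u' v.
Proof. by rewrite /wtwist wtM parM twistDl. Qed.

Lemma wtwist1l v : wtwist mone v = 1.
Proof. by rewrite /wtwist wt1 par1 twist0l. Qed.

Lemma wtwist1r u : wtwist u mone = 1.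
Proof. by rewrite /wtwist wt1 par1 twist0r. Qed.

(** * The skew derivations *)

Definition gen_norm a : Qq :=
  (1 - (-1) ^+ par_gen a * qi D (idx a) ^+ (2 * lev a))^-1.

(** The contraction of the left factor of rho against the generator a, unfolded
    on words: in rho b * rho w only b (x) 1 can make b the left factor, and
    1 (x) b passes a left factor a at the cost of the twist of b and a. *)
Fixpoint skewder_seq a (s : seq (Iinf D)) : F :=
  if s is b :: s' then
    ((a == b)%:R * gen_norm a) *: << FMonom s' >>
      + wtwist (fmu b) (fmu a) *: (<< fmu b >> * skewder_seq a s')
  else 0.

Definition skewder a : F -> F := linext (fun w : word D => skewder_seq a w).

Lemma skewder_is_linear a : linear (skewder a).
Proof. exact: linext_is_linear. Qed.

Lemma skewderU a w : skewder a << w >> = skewder_seq a w.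
Proof. exact: linextU. Qed.

Lemma skewder_1 a : skewder a 1 = 0.
Proof. by rewrite skewderU fm1. Qed.

Lemma skewder_genM a b y :
  skewder a (<< fmu b >> * y) = ((a == b)%:R * gen_norm a) *: y
    + wtwist (fmu b) (fmu a) *: (<< fmu b >> * skewder a y).
Proof.
apply: (malg_linear_eq (f := fun y => skewder a (<< fmu b >> * y))
  (g := fun y => ((a == b)%:R * gen_norm a) *: y
    + wtwist (fmu b) (fmu a) *: (<< fmu b >> * skewder a y))).
- exact: linear_comp (skewder_is_linear a) (malg_linear_mull _).
- apply: linear_comb => //.
  exact: linear_comp (malg_linear_mull _) (skewder_is_linear a).
by move=> w _; rewrite malgMUU !skewderU fmM fmU [LHS]/= fmK.
Qed.

Lemma skewder_mulU a u y :
  skewder a (<< u >> * y) =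
  skewder a << u >> * y + wtwist u (fmu a) *: (<< u >> * skewder a y).
Proof.
elim/word_ind: u => [|b u IHu].
  by rewrite -[<< mone >>]/(1 : F) skewder_1
    !mul1r mul0r add0r wtwist1l scale1r.
rewrite -malgMUU wtwistMl.
exact: (skew_leibniz (@malgZAr _ _) (skewder_genM a b) IHu).
Qed.

(** Removing a letter a lowers the weight by that of a; this is what makes the
    twists below computable after a skew derivation has been applied. *)
Lemma skewder_homogeneous a x mu e : homogeneous x mu e ->
  homogeneous (skewder a x) (mu - wt (fmu a)) (e (+) par (fmu a)).
Proof.
move=> hx; apply: homogeneous_lin => [|w /hx[<- <-]].
  exact: skewder_is_linear.
elim/word_ind: w {x mu e hx} => [|b w IHw].
  by rewrite [skewder _ _]skewder_1; apply: homogeneous0.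
rewrite -malgMUU skewder_genM; apply: homogeneousD.
  case: (a =P b) => [->|_]; last first.
    by rewrite mulr0n mul0r scale0r; apply: homogeneous0.
  rewrite wtM parM addrAC subrr add0r addbAC addbb /=.
  exact: homogeneousZ (@homogeneousU w).
rewrite wtM parM -addrA -addbA.
exact: homogeneousZ (homogeneous_mulU IHw).
Qed.

(** * Skew derivations and the coproduct *)

Lemma tens_linearl y : linear (fun x => tens x y).
Proof. by move=> c x x'; exact: tensPl. Qed.

Lemma tens_linearr x : linear (tens x).
Proof. by move=> c y y'; exact: tensPr. Qed.

Lemma rho_genM_tens b x y mu e : homogeneous x mu e ->
  rho << fmu b >> * tens x y =
    tens (<< fmu b >> * x) y
      + twist D (wt (fmu b)) mu (par (fmu b)) e *: tens x (<< fmu b >> * y).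
Proof.
move=> hx; rewrite (rho_gen b) mulrDl; congr (_ + _).
  rewrite (tensM _ _ (@homogeneousU mone) hx) wt1 par1 twist0l scale1r.
  exact: (congr1 (tens _) (mul1r y)).
rewrite (tensM _ _ (@homogeneousU (fmu b)) hx).
exact: (congr1 (fun z => _ *: tens z _) (mul1r x)).
Qed.

Lemma rho_genM_UU b u v :
  rho << fmu b >> * (<< (u, v) >> : FF) =
    tens << mmul (fmu b) u >> << v >>
      + wtwist (fmu b) u *: tens << u >> << mmul (fmu b) v >>.
Proof.
rewrite -tensUU (rho_genM_tens _ _ (@homogeneousU u)).
by rewrite (malgMUU _ _ u) (malgMUU _ _ v).
Qed.

Lemma tform_linearl (B : F -> F -> Qq) (Z : FF) :
  linear (fun T : FF => tform B T Z : Qq^o).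
Proof. by move=> c T T'; exact: tformPl. Qed.

Lemma tform_linearr (B : F -> F -> Qq) (Z : FF) :
  linear (tform B Z : FF -> Qq^o).
Proof. by move=> c T T'; exact: tformPr. Qed.

(** d_a (x) id on F (x) F. *)
Definition skewderl a : FF -> FF :=
  linext (fun k : word D * word D => tens (skewder a << k.1 >>) << k.2 >>).

Lemma skewderl_is_linear a : linear (skewderl a).
Proof. exact: linext_is_linear. Qed.

Lemma skewderl_tens a x y : skewderl a (tens x y) = tens (skewder a x) y.
Proof.
apply: (malg_linear_eq (f := fun x => skewderl a (tens x y))
  (g := fun x => tens (skewder a x) y)).
- exact: linear_comp (skewderl_is_linear a) (tens_linearl y).
- exact: linear_comp (tens_linearl y) (skewder_is_linear a).
move=> u _; apply: (malg_linear_eq (f := fun y => skewderl a (tens << u >> y))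
  (g := tens (skewder a << u >>))).
- exact: linear_comp (skewderl_is_linear a) (tens_linearr _).
- exact: tens_linearr.
by move=> v _; rewrite tensUU /skewderl linextU.
Qed.

(** The recursion of [skewder_genM] holds verbatim in F (x) F with rho b in place
    of b. For the term b (x) 1 this is that recursion in the left factor; for
    1 (x) b, the twist of b with u splits as the twist of b with a times the
    twist of b with d_a u. *)
Lemma skewderl_rho_genM a b (Z : FF) :
  skewderl a (rho << fmu b >> * Z) = ((a == b)%:R * gen_norm a) *: Z
    + wtwist (fmu b) (fmu a) *: (rho << fmu b >> * skewderl a Z).
Proof.
apply: (malg_linear_eq (f := fun Z : FF => skewderl a (rho << fmu b >> * Z))
  (g := fun Z : FF => ((a == b)%:R * gen_norm a) *: Z
    + wtwist (fmu b) (fmu a) *: (rho << fmu b >> * skewderl a Z))).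
- exact: linear_comp (skewderl_is_linear a) (linear_mull _).
- apply: linear_comb; first exact: linear_id.
  exact: linear_comp (linear_mull _) (skewderl_is_linear a).
case=> u v _; have hu := @homogeneousU u.
have hd := skewder_homogeneous (a := a) hu.
have Et : wtwist (fmu b) (fmu a)
    * twist D (wt (fmu b)) (wt u - wt (fmu a)) (par (fmu b))
        (par u (+) par (fmu a)) = wtwist (fmu b) u.
  by rewrite /wtwist -twistDr addrC subrK addbC addbK.
have -> : (<< (u, v) >> : FF) = tens << u >> << v >> by rewrite tensUU.
have EP : skewderl a (tens (<< fmu b >> * << u >>) << v >>)
    = ((a == b)%:R * gen_norm a) *: tens << u >> << v >>
      + wtwist (fmu b) (fmu a) *: tens (<< fmu b >> * skewder a << u >>) << v >>.
  rewrite skewderl_tens skewder_genM tensPl; congr (_ + _).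
  exact (linear_Z (tens_linearl _) _ _).
have EM := etrans (congr1 (fun Z : FF => rho << fmu b >> * Z)
  (skewderl_tens a << u >> << v >>)) (rho_genM_tens b << v >> hd).
exact (linear_twisted_sum (skewderl_is_linear a)
  (rho_genM_tens b << v >> hu) EP (skewderl_tens _ _ _) EM Et).
Qed.

(** Both sides satisfy the same recursion on the word y, since rho is
    multiplicative. *)
Lemma rho_skewder a y : rho (skewder a y) = skewderl a (rho y).
Proof.
apply: (malg_linear_eq (f := fun y => rho (skewder a y))
  (g := fun y => skewderl a (rho y))).
- exact: linear_comp (@rho_is_linear I D) (skewder_is_linear a).
- exact: linear_comp (skewderl_is_linear a) (@rho_is_linear I D).
move=> w _; elim/word_ind: w => [|b w IHw].
  rewrite skewder_1 (linear_0 (@rho_is_linear I D)) (rmorph1 (@rho I D)).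
  by rewrite /skewderl linextU /= [skewder a _]skewder_1 tens0l.
rewrite -malgMUU skewder_genM (rmorphM (@rho I D)) skewderl_rho_genM -IHw.
by rewrite (rho_is_linear _ << w >>) (linear_Z (@rho_is_linear I D))
  (rmorphM (@rho I D)).
Qed.

(** * The form and property (c) *)

Definition word_functional (s : seq (Iinf D)) : F -> Qq :=
  foldr (fun a f => f \o skewder a) (mcoeff mone) s.

Lemma word_functional_is_linear s : linear (word_functional s : F -> Qq^o).
Proof.
elim: s => [|a s IHs] /=; last exact: linear_comp IHs (skewder_is_linear a).
by move=> c x y; rewrite mcoeffD mcoeffZ.
Qed.

Definition lusztig_form x y : Qq :=
  linext (fun u : word D => word_functional u y : Qq^o) x.

Lemma lusztig_form_linearl y : linear (lusztig_form ^~ y : F -> Qq^o).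
Proof. exact: linext_is_linear. Qed.

Lemma lusztig_form_linearr x : linear (lusztig_form x : F -> Qq^o).
Proof.
move=> c y y'; rewrite /lusztig_form -linextDZ; apply: eq_linext => u.
exact: word_functional_is_linear.
Qed.

HB.instance Definition _ := bilinear_isBilinear.Build Qq F F Qq *%R *%R
  lusztig_form
  ((fun y c => lusztig_form_linearl y c), (fun x c => lusztig_form_linearr x c)).

Lemma lusztig_formU u y : lusztig_form << u >> y = word_functional u y.
Proof. exact: (linextU (V := Qq^o)). Qed.

Lemma lusztig_form_1l y : lusztig_form 1 y = y@_mone.
Proof. by rewrite lusztig_formU fm1. Qed.

Lemma lusztig_form_genM a x y :
  lusztig_form (<< fmu a >> * x) y = lusztig_form x (skewder a y).
Proof.
apply: (malg_linear_eq (V := Qq^o)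
  (f := fun x => lusztig_form (<< fmu a >> * x) y)
  (g := fun x => lusztig_form x (skewder a y))).
- exact: linear_comp (lusztig_form_linearl y) (malg_linear_mull _).
- exact: lusztig_form_linearl.
by move=> u _; rewrite malgMUU !lusztig_formU fmM fmU.
Qed.

(** Orthogonality of distinct weights or parities: each letter a of u lowers the
    weight of y by that of a, and in the end only weight 0 pairs with 1. *)
Lemma lusztig_form_wt u y mu e : homogeneous y mu e ->
  lusztig_form << u >> y != 0 -> wt u = mu /\ par u = e.
Proof.
elim/word_ind: u y mu e => [|a u IHu] y mu e hy.
  by rewrite lusztig_form_1l mcoeff_neq0 => /hy[].
rewrite -malgMUU lusztig_form_genM => /(IHu _ _ _ (skewder_homogeneous hy))[].
by rewrite wtM parM => -> ->; rewrite addrC subrK addbC addbK.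
Qed.

(** eps (x) id, where eps is the constant coefficient, identifying Q(q) (x) F
    with F. *)
Definition counitl : FF -> F :=
  linext (fun k : word D * word D => (k.1 == mone)%:R *: << k.2 >>).

Lemma counitl_is_linear : linear counitl.
Proof. exact: linext_is_linear. Qed.

Lemma counitl_tensUU u v :
  counitl (tens << u >> << v >>) = (u == mone)%:R *: << v >>.
Proof. by rewrite tensUU /counitl linextU. Qed.

(** The term b (x) 1 of rho b is killed, because its product with anything has a
    nonempty left factor; 1 (x) b acts on what remains, without any twist as the
    left factor is then empty. *)
Lemma counitl_rho_genM b (Z : FF) :
  counitl (rho << fmu b >> * Z) = << fmu b >> * counitl Z.
Proof.
apply: (malg_linear_eq (f := fun Z : FF => counitl (rho << fmu b >> * Z))
  (g := fun Z : FF => << fmu b >> * counitl Z)).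
- exact: linear_comp counitl_is_linear (linear_mull _).
- exact: linear_comp (malg_linear_mull _) counitl_is_linear.
case=> u v _; rewrite rho_genM_UU (linear_addZ counitl_is_linear).
have E1 := counitl_tensUU (mmul (fmu b) u) v.
have E2 := counitl_tensUU u (mmul (fmu b) v).
have E3 := etrans (congr1 counitl (esym (tensUU u v))) (counitl_tensUU u v).
apply: etrans (congr2 (fun x y => x + wtwist (fmu b) u *: y) E1 E2) _.
apply: etrans _ (esym (congr1 (fun x => << fmu b >> * x) E3)).
have -> : (mmul (fmu b) u == mone) = false by rewrite fmM_eq1 fm1_eq1.
rewrite (scale0r << v >>) add0r -(malgZAr (u == mone)%:R) malgMUU.
have [->|_] := eqVneq u mone.
  by rewrite wtwist1r; exact: scale1r.
by rewrite mulr0n (scale0r << mmul (fmu b) v >>); exact: scaler0.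
Qed.

Lemma counitl_rho y : counitl (rho y) = y.
Proof.
apply: (malg_linear_eq (f := fun y => counitl (rho y)) (g := id)).
- exact: linear_comp counitl_is_linear (@rho_is_linear I D).
- exact: linear_id.
move=> w _; elim/word_ind: w => [|b w IHw].
  rewrite (rmorph1 (@rho I D)) -[1]/(<< (mone, mone) >> : FF) -tensUU.
  by rewrite counitl_tensUU eqxx scale1r.
rewrite -malgMUU (rmorphM (@rho I D)) counitl_rho_genM.
by congr (_ * _).
Qed.

Lemma tform_lusztig x1 x2 x3 x4 :
  tform lusztig_form (tens x1 x2) (tens x3 x4) =
    lusztig_form x1 x3 * lusztig_form x2 x4.
Proof. exact: tform_tens. Qed.

(** Combined with [rho_skewder], this moves a letter of the left argument of (c)
    across the form on both sides of the equation. *)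
Lemma tform_genM_tens a x x' (Z : FF) :
  tform lusztig_form (tens (<< fmu a >> * x) x') Z =
    tform lusztig_form (tens x x') (skewderl a Z).
Proof.
apply: (malg_linear_eq (V := Qq^o)
  (f := fun Z : FF => tform lusztig_form (tens (<< fmu a >> * x) x') Z)
  (g := fun Z : FF => tform lusztig_form (tens x x') (skewderl a Z))).
- exact: tform_linearr.
- exact: linear_comp (tform_linearr _ _) (skewderl_is_linear a).
case=> u v _.
have -> : (<< (u, v) >> : FF) = tens << u >> << v >> by rewrite tensUU.
rewrite skewderl_tens.
apply: etrans (tform_lusztig _ _ _ _) (etrans _ (esym (tform_lusztig _ _ _ _))).
by rewrite (lusztig_form_genM a x).
Qed.

Lemma lusztig_form_mull x x' y :
  lusztig_form (x * x') y = tform lusztig_form (tens x x') (rho y).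
Proof.
apply: (malg_linear_eq (V := Qq^o) (f := fun x => lusztig_form (x * x') y)
  (g := fun x => tform lusztig_form (tens x x') (rho y))).
- exact: linear_comp (lusztig_form_linearl y) (linear_mulr _).
- exact: linear_comp (tform_linearl _ _) (tens_linearl _).
move=> u _; elim/word_ind: u y => [|a u IHu] y; last first.
  rewrite -malgMUU -(mulrA << fmu a >>) lusztig_form_genM IHu rho_skewder.
  exact: esym (tform_genM_tens _ _ _ _).
rewrite (mul1r x') -{1}(counitl_rho y); move: (rho y) => Z.
apply: (malg_linear_eq (V := Qq^o)
  (f := fun Z : FF => lusztig_form x' (counitl Z))
  (g := fun Z : FF => tform lusztig_form (tens << mone >> x') Z)).
- exact: linear_comp (lusztig_form_linearr x') counitl_is_linear.
- exact: tform_linearr.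
case=> v w _.
have -> : (<< (v, w) >> : FF) = tens << v >> << w >> by rewrite tensUU.
rewrite counitl_tensUU; apply: etrans _ (esym (tform_lusztig _ _ _ _)).
rewrite (lusztig_form_1l << v >>) mcoeffU1.
exact: (linear_Z (lusztig_form_linearr x')).
Qed.

(** * Properties (a) and (b) *)

(** Unless the pairing vanishes, u and v have the same weight and parity, so they
    have the same twist with a. *)
Lemma lusztig_form_wtwist a u v :
  wtwist (fmu a) u * lusztig_form << u >> << v >> =
    wtwist v (fmu a) * lusztig_form << u >> << v >>.
Proof.
have [->|/(lusztig_form_wt (@homogeneousU v))[wtu paru]] :=
  eqVneq (lusztig_form << u >> << v >>) 0.
  by rewrite !mulr0.
by rewrite /wtwist wtu paru [in LHS]twistC.
Qed.

(** The adjoint of left multiplication by rho a is the twisted Leibniz rule for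
    d_a. The adjunction naturally produces the twist of a with the left factor of
    Z; it is replaced by the twist of v with a using [lusztig_form_wtwist]. *)
Lemma tform_rho_genM a v y (Z : FF) :
  tform lusztig_form (rho << fmu a >> * Z) (tens << v >> y) =
    tform lusztig_form Z (tens (skewder a << v >>) y)
      + wtwist v (fmu a) * tform lusztig_form Z (tens << v >> (skewder a y)).
Proof.
apply: (malg_linear_eq (V := Qq^o)
  (f := fun Z : FF => tform lusztig_form (rho << fmu a >> * Z) (tens << v >> y))
  (g := fun Z : FF => tform lusztig_form Z (tens (skewder a << v >>) y)
      + wtwist v (fmu a) * tform lusztig_form Z (tens << v >> (skewder a y)))).
- exact: linear_comp (tform_linearl _ _) (linear_mull _).
- apply: linear_add; first exact: tform_linearl.
  exact: linear_scale (tform_linearl _ _).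
case=> u w _; rewrite rho_genM_UU -tensUU.
rewrite (linear_addZ (tform_linearl _ _)) -(malgMUU _ _ u) -(malgMUU _ _ w).
have E1 := etrans (tform_lusztig (<< fmu a >> * << u >>) << w >> << v >> y)
  (congr1 (fun r => r * _) (lusztig_form_genM a << u >> << v >>)).
have E2 := etrans (tform_lusztig << u >> (<< fmu a >> * << w >>) << v >> y)
  (congr1 (fun r => _ * r) (lusztig_form_genM a << w >> y)).
apply: etrans (congr2 (fun p r => p + wtwist (fmu a) u * r) E1 E2) _.
apply: etrans _ (esym (congr2 (fun p r => p + wtwist v (fmu a) * r)
  (tform_lusztig _ _ _ _) (tform_lusztig _ _ _ _))).
congr (_ + _); rewrite [LHS]mulrA [RHS]mulrA.
exact: (congr1 (fun r => r * _) (lusztig_form_wtwist a u v)).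
Qed.

Lemma mcoeff_mone_mul y y' : (y * y')@_mone = y@_mone * y'@_mone.
Proof. exact: (mcoeff1g_is_multiplicative _ _).1. Qed.

(** Induction on the word x: the case a u is the Leibniz rule on one side and its
    transported form [tform_rho_genM] on the other. The induction hypothesis is
    needed for all y and y', as both get derived. *)
Lemma lusztig_form_mulr x y y' :
  lusztig_form x (y * y') = tform lusztig_form (rho x) (tens y y').
Proof.
apply: (malg_linear_eq (V := Qq^o) (f := fun x => lusztig_form x (y * y'))
  (g := fun x => tform lusztig_form (rho x) (tens y y'))).
- exact: lusztig_form_linearl.
- exact: linear_comp (tform_linearl _ _) (@rho_is_linear I D).
move=> u _; elim/word_ind: u y y' => [|a u IHu] y y'.
  rewrite (rmorph1 (@rho I D)) (lusztig_form_1l (y * y')).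
  have -> : 1 = tens << mone >> << mone >> :> FF by rewrite tensUU.
  apply: etrans _ (esym (tform_lusztig _ _ _ _)).
  rewrite (lusztig_form_1l y) (lusztig_form_1l y').
  exact: mcoeff_mone_mul.
apply: (malg_linear_eq (V := Qq^o)
  (f := fun y => lusztig_form << mmul (fmu a) u >> (y * y'))
  (g := fun y => tform lusztig_form (rho << mmul (fmu a) u >>) (tens y y'))).
- exact: linear_comp (lusztig_form_linearr _) (linear_mulr _).
- exact: linear_comp (tform_linearr _ _) (tens_linearl _).
move=> v _; rewrite -malgMUU lusztig_form_genM skewder_mulU.
apply: etrans (linear_addZ (lusztig_form_linearr << u >>) _ _ _) _.
apply: etrans (congr2 (fun p r => p + wtwist v (fmu a) * r)
  (IHu _ _) (IHu _ _)) _.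
by rewrite (rmorphM (@rho I D)) tform_rho_genM.
Qed.

Lemma skewder_gen a b : skewder a (gen b) = ((a == b)%:R * gen_norm a) *: 1.
Proof.
rewrite skewderU fmU [LHS]/= (mulr0 << fmu b >>) scaler0 addr0 -fmoneE.
by [].
Qed.

Lemma eq_idx_lev a b :
  (idx a == idx b)%:R * (lev a == lev b)%:R = (a == b)%:R :> Qq.
Proof. by rewrite -natrM mulnb. Qed.

Lemma lusztig_form_gen a b :
  lusztig_form (gen a) (gen b) = (a == b)%:R * gen_norm a.
Proof.
rewrite lusztig_formU fmU -[LHS]/((skewder a (gen b))@_mone) skewder_gen.
rewrite mcoeffZ mcoeff1 eqxx; exact: mulr1.
Qed.

Lemma lusztig_form_is_lusztig : is_lusztig_form lusztig_form.
Proof.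
split; first by rewrite lusztig_form_1l mcoeff1 eqxx.
- by move=> a b; rewrite lusztig_form_gen eq_idx_lev.
- exact: lusztig_form_mulr.
- exact: lusztig_form_mull.
Qed.

(** * Uniqueness *)

Lemma bilin_linearl (B : {bilinear F -> F -> Qq | *%R & *%R}) y :
  linear (B ^~ y : F -> Qq^o).
Proof. by move=> c x x'; exact: linearPl. Qed.

Lemma bilin_linearr (B : {bilinear F -> F -> Qq | *%R & *%R}) x :
  linear (B x : F -> Qq^o).
Proof. by move=> c y y'; exact: linearPr. Qed.

Lemma tformDl (B : F -> F -> Qq) (Z Z' T : FF) :
  tform B (Z + Z') T = tform B Z T + tform B Z' T.
Proof. by rewrite -(scale1r Z) tformPl mul1r scale1r. Qed.

Lemma tformDr (B : F -> F -> Qq) (Z T T' : FF) :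
  tform B Z (T + T') = tform B Z T + tform B Z T'.
Proof. by rewrite -(scale1r T) tformPr mul1r scale1r. Qed.

Lemma add_self_eq0 (A : nzRingType) (e r : A) :
  e = 1 -> r = r * e + e * r -> r = 0.
Proof.
by move=> ->; rewrite mulr1 mul1r => e2; apply: (addrI r); rewrite addr0 -e2.
Qed.

Lemma addr_mul0l (A : nzRingType) (p r s : A) : r = 0 -> p + r * s = p.
Proof. by move=> ->; rewrite mul0r addr0. Qed.

Section Uniqueness.
Variable B : {bilinear F -> F -> Qq | *%R & *%R}.

(** Applying (c) to 1 = 1 * 1 gives (1, b) = 2 (1, b); dually below with (b). *)
Lemma lusztig_1_gen b : is_lusztig_form B ->
  B 1 (gen b) = 0.
Proof.
case=> B11 _ _ Hc; apply: (add_self_eq0 B11).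
apply: etrans (esym (congr1 (B ^~ (gen b)) (mul1r (1 : F)))) _.
apply: etrans (Hc 1 1 (gen b)) _; rewrite rho_gen tformDr.
by congr (_ + _); exact: tform_tens.
Qed.

Lemma lusztig_gen_1 a : is_lusztig_form B ->
  B (gen a) 1 = 0.
Proof.
case=> B11 _ Hb _; apply: (add_self_eq0 B11).
apply: etrans (esym (congr1 (B (gen a)) (mul1r (1 : F)))) _.
apply: etrans (Hb (gen a) 1 1) _; rewrite rho_gen tformDl.
by congr (_ + _); exact: tform_tens.
Qed.

Lemma lusztig_1_genM b y : is_lusztig_form B ->
  B 1 (gen b * y) = 0.
Proof.
move=> lusB; have [_ _ Hb _] := lusB; rewrite Hb (rmorph1 (@rho I D)).
have -> : 1 = tens 1 1 :> FF by rewrite tensUU.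
apply: etrans (tform_tens B _ _ _ _) _.
rewrite lusztig_1_gen //; exact: mul0r.
Qed.

Lemma lusztig_gen_genM a b y : is_lusztig_form B ->
  B (gen a) (gen b * y) = B (gen a) (gen b) * B 1 y.
Proof.
move=> lusB; have [_ _ Hb _] := lusB; rewrite Hb rho_gen tformDl.
apply: etrans (congr2 +%R (tform_tens B _ _ _ _) (tform_tens B _ _ _ _)) _.
exact: addr_mul0l (lusztig_1_gen b lusB).
Qed.
End Uniqueness.

(** By (c) the pairing of a u with y is that of a (x) u with rho y, hence is
    determined by the pairings of a, known directly, and those of u, known by
    induction. *)
Lemma lusztig_unique (B1 B2 : {bilinear F -> F -> Qq | *%R & *%R}) :
  is_lusztig_form B1 -> is_lusztig_form B2 -> forall x y, B1 x y = B2 x y.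
Proof.
move=> H1 H2.
have [B11 Bg1 _ Bc1] := H1; have [B12 Bg2 _ Bc2] := H2.
have E1 y : B1 1 y = B2 1 y.
  apply: (malg_linear_eq (V := Qq^o) (f := B1 1) (g := B2 1));
    [exact: bilin_linearr|exact: bilin_linearr|].
  move=> w _; elim/word_ind: w => [|b w _]; first exact: etrans B11 (esym B12).
  rewrite -malgMUU.
  exact: etrans (lusztig_1_genM b _ H1) (esym (lusztig_1_genM b _ H2)).
have Eg a y : B1 (gen a) y = B2 (gen a) y.
  apply: (malg_linear_eq (V := Qq^o) (f := B1 (gen a)) (g := B2 (gen a)));
    [exact: bilin_linearr|exact: bilin_linearr|].
  move=> w _; elim/word_ind: w => [|b w _].
    exact: etrans (lusztig_gen_1 a H1) (esym (lusztig_gen_1 a H2)).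
  rewrite -malgMUU (lusztig_gen_genM a b _ H1) E1.
  rewrite (etrans (Bg1 a b) (esym (Bg2 a b))).
  exact: esym (lusztig_gen_genM a b _ H2).
move=> x y; apply: (malg_linear_eq (V := Qq^o) (f := B1 ^~ y) (g := B2 ^~ y));
  [exact: bilin_linearl|exact: bilin_linearl|].
move=> u _; elim/word_ind: u y => [|a u IHu] y; first exact: E1.
rewrite -malgMUU Bc1 Bc2; move: (rho y) => Z.
apply: (malg_linear_eq (V := Qq^o)
  (f := tform B1 (tens << fmu a >> << u >>))
  (g := tform B2 (tens << fmu a >> << u >>))).
- exact: tform_linearr.
- exact: tform_linearr.
case=> v w _.
have -> : (<< (v, w) >> : FF) = tens << v >> << w >> by rewrite tensUU.
apply: etrans (tform_tens B1 _ _ _ _) (etrans _ (esym (tform_tens B2 _ _ _ _))).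
exact: congr2 (Eg a << v >>) (IHu << w >>).
Qed.

(** * Symmetry *)

Section Transpose.
Variable B : {bilinear F -> F -> Qq | *%R & *%R}.

Definition transpose x y := B y x.

Lemma transpose_linearl y : linear (transpose ^~ y : F -> Qq^o).
Proof. exact: bilin_linearr. Qed.

Lemma transpose_linearr x : linear (transpose x : F -> Qq^o).
Proof. exact: bilin_linearl. Qed.

HB.instance Definition _ := bilinear_isBilinear.Build Qq F F Qq *%R *%R transpose
  ((fun y c => transpose_linearl y c), (fun x c => transpose_linearr x c)).

Lemma tform_transpose (Z T : FF) : tform transpose Z T = tform B T Z.
Proof.
apply: (malg_linear_eq (V := Qq^o) (f := fun Z : FF => tform transpose Z T)
  (g := fun Z : FF => tform B T Z)).
- exact: tform_linearl.
- exact: tform_linearr.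
move=> k _; apply: (malg_linear_eq (V := Qq^o)
  (f := fun T : FF => tform transpose << k >> T)
  (g := fun T : FF => tform B T << k >>)).
- exact: tform_linearr.
- exact: tform_linearl.
by move=> l _; rewrite /tform !bilextUU.
Qed.

Lemma transpose_is_lusztig : is_lusztig_form B -> is_lusztig_form transpose.
Proof.
case=> B11 Bg Bb Bc; split; first exact: B11.
- move=> a b; rewrite /transpose Bg !eq_idx_lev eq_sym.
  by case: eqVneq => [->|_] //; rewrite mulr0n !mul0r.
- by move=> x y y'; rewrite tform_transpose; exact: Bc.
- by move=> x x' y; rewrite tform_transpose; exact: Bb.
Qed.
End Transpose.
End Form.

Theorem proposition1p1 (I : countType) (D : bcDatum I) :
  exists B : {bilinear freeF D -> freeF D -> Qq | *%R & *%R},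
    [/\ is_lusztig_form B,
        forall B' : {bilinear freeF D -> freeF D -> Qq | *%R & *%R},
          is_lusztig_form B' -> forall x y, B' x y = B x y &
        forall x y, B x y = B y x].
Proof.
exists (@lusztig_form I D); split.
- exact: lusztig_form_is_lusztig.
- move=> B' HB'; exact: lusztig_unique HB' (lusztig_form_is_lusztig D).
- exact: lusztig_unique (lusztig_form_is_lusztig D)
    (transpose_is_lusztig (lusztig_form_is_lusztig D)).
Qed.
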